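(* For integers $n\ge1$ let $h(n):=\max\{l\in\mathbb{Z}:n+1-2l\ge0\}$ and, for $0\le l\le h(n)$, $$q(n,l):=\begin{cases}\binom{n-1}{l}&\text{if } l=0,1,\\[4pt]\binom{n+1}{l}-\binom{n+1}{l-1}-\binom{n-1}{l-1}+\binom{n-1}{l-2}&\text{if } l\ge2.\end{cases}$$ Then: (1) if $n\geq 1$ is even, then $q(n,h(n))=q(n+1,h(n+1))$; (2) if $n\ge2$, then $q(n,l)+q(n,l+1)=q(n+1,l+1)$ for all $l\geq 0$ with $l+1\le h(n)$.
   Context: $\binom{m}{j}$ denotes the binomial coefficient, equal to $0$ if $j>m$. *)

(* Defs.v *)
From mathcomp Require Import all_boot all_order all_algebra.
From mathcomp Require Import zify.
Set Implicit Arguments.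
Unset Strict Implicit.
Unset Printing Implicit Defensive.
Import Order.TTheory GRing.Theory Num.Theory.
Local Open Scope ring_scope.

(* The maximum over all integers l of the condition n + 1 - 2 l >= 0: the
   maximizer is nonnegative and at most n + 1, so it is enough to range over
   'I_n.+2; hP states the characterization over the whole of int. *)
Definition h (n : nat) : nat :=
  (\max_(l < n.+2 | (0 <= n%:Z + 1 - 2 * l%:Z)%R) l)%N.

Lemma hP (n : nat) :
  0 <= n%:Z + 1 - 2 * (h n)%:Z /\
  (forall l : int, 0 <= n%:Z + 1 - 2 * l -> l <= (h n)%:Z).
Proof.
split.
  rewrite /h; apply: (big_ind (fun m : nat => 0 <= n%:Z + 1 - 2 * m%:Z)) => //.
  by move=> x y hx hy; case: (leqP x y).
case=> [l|l] hl; last lia.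
have ltl : (l < n.+2)%N by lia.
rewrite lez_nat /h.
exact: (@leq_bigmax_cond _ (fun l : 'I_n.+2 => 0 <= n%:Z + 1 - 2 * l%:Z)
  (fun l => nat_of_ord l) (Ordinal ltl)).
Qed.

(* Integer-valued, so that the subtractions are not truncated. It is total in n
   and l, and meaningful only for 1 <= n and l <= h n. *)
Definition q (n l : nat) : int :=
  if (l <= 1)%N then 'C(n.-1, l)%:Z
  else 'C(n.+1, l)%:Z - 'C(n.+1, l.-1)%:Z - 'C(n.-1, l.-1)%:Z
       + 'C(n.-1, l.-2)%:Z.

(* Main.v *)
Require Import Defs.
From mathcomp Require Import all_boot all_order all_algebra.
From mathcomp Require Import zify.
Local Open Scope ring_scope.

(** With binomials of negative lower index read as 0, the formula for [q n l]
    with 2 <= l also gives the values at l = 0 and l = 1, so that [q n l] is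
    for every l the coefficient of x^l in
      (1 + x)^(n-1) ((1 + x)^2 (1 - x) - x (1 - x)) = (1 + x)^(n-1) (1 - x^3).
    In other words q n l = C(n-1, l) - C(n-1, l-3), which is [q_binE].

    Part (2) is then Pascal's rule, applied to both binomials
    ([q_pascal]).  For part (1), write n = 2m; then h n = m and
    h (n+1) = m + 1 ([h_uphalf]).  Pascal's rule gives
    q (2m+1) (m+1) = q (2m) m + q (2m) (m+1), and the last term
    C(2m-1, m+1) - C(2m-1, m-2) vanishes because the two lower indices add up
    to 2m - 1 ([q_antisym]). *)

Lemma h_uphalf (n : nat) : h n = uphalf n.
Proof. by have [h_le h_max] := hP n; have := h_max (uphalf n)%:Z; lia. Qed.

(** Coefficient form of (1 + x)^m (1 - x^3); the match implements the convention
    that a binomial with a negative lower index is 0. *)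
Lemma q_binE (m l : nat) :
  q m.+1 l = 'C(m, l)%:Z - (if l is k.+3 then 'C(m, k) else 0)%:Z.
Proof.
by case: l => [|[|[|l]]]; rewrite /q /= ?binS ?bin0 ?bin1; lia.
Qed.

(** Multiplication by 1 + x takes the generating polynomial for one value of n
    to the next one. *)
Lemma q_pascal (n l : nat) :
  (0 < n)%N -> q n l + q n l.+1 = q n.+1 l.+1.
Proof.
case: n => // m _; rewrite !q_binE binS.
by case: l => [|[|[|l]]]; rewrite ?binS ?bin0; lia.
Qed.

(** (1 + x)^(2m-1) (1 - x^3) is antipalindromic of even degree 2m + 2, so its
    middle coefficient is 0. *)
Lemma q_antisym (m : nat) : (0 < m)%N -> q m.*2 m.+1 = 0.
Proof.
case: m => [//|[|m]] _; first by rewrite q_binE.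
rewrite doubleS q_binE -(@bin_sub _ m); last by lia.
have -> : ((m.+1).*2.+1 - m = m.+3)%N by lia.
exact: GRing.subrr.
Qed.

Theorem lemma4p10 :
  (forall n : nat, (1 <= n)%N -> ~~ odd n -> q n (h n) = q n.+1 (h n.+1)) /\
  (forall n : nat, (2 <= n)%N -> forall l : nat, (l.+1 <= h n)%N ->
     q n l + q n l.+1 = q n.+1 l.+1).
Proof.
split=> [n n_gt0 n_even | n n_gt1 l _]; last by apply: q_pascal; lia.
have [m n_eq] : exists m, n = m.*2 by exists n./2; lia.
have m_gt0 : (0 < m)%N by lia.
rewrite !h_uphalf n_eq uphalf_double /= doubleK -q_pascal; last by lia.
by rewrite q_antisym // GRing.addr0.
Qed.
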